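(* Let $\mathbb{K}$ be a field and let $\mathcal{A}$ be a torsion free $\mathbb{K}[t^{\pm1}]$-algebra. Consider an Ore extension $\mathcal{R}=\mathcal{A}[x;\sigma,\Delta]$, where $\sigma$ is a $\mathbb{K}[t^{\pm1}]$-algebra automorphism of $\mathcal{A}$ and $\Delta$ is a $\mathbb{K}[t^{\pm1}]$-linear $\sigma$-derivation of $\mathcal{A}$, and suppose that $R:=\mathcal{R}/(t-1)\mathcal{R}$ is a commutative $\mathbb{K}$-algebra. Equip $R$ with the semiclassical limit Poisson bracket. Then: 1. $R$ is a Poisson-Ore extension of the form $A[X;\alpha,\delta]_P$, where $A=\mathcal{A}/(t-1)\mathcal{A}$, $X=\overline{x}$, $\alpha$ is a Poisson derivation of $A$ and $\delta$ is a Poisson $\alpha$-derivation of $A$. More precisely, for all $a\in\mathcal{A}$, $$\alpha(\overline a)=\frac{\sigma(a)-a}{t-1}\Big|_{t=1},\qquad \delta(\overline a)=\frac{\Delta(a)}{t-1}\Big|_{t=1}.$$ 2. Suppose furthermore that $\Delta\sigma=t^{\eta}\sigma\Delta$ for some integer $\eta$ whose image in $\mathbb{K}$ is nonzero, and that $\Delta^i(\mathcal{A})\subseteq(t-1)^i(i)!_{t^\eta}\mathcal{A}$ for all $i\ge0$. Then $\delta$ extends to an iterative higher $(\eta,\alpha)$-skew Poisson derivation $(D_i)$ on $A$, which is locally nilpotent if $\Delta$ is locally nilpotent. More precisely, $D_i$ is defined by $$D_i(\overline a)=\Big(\frac{\Delta^i(a)}{(t-1)^i(i)!_{t^\eta}}\Big)\Big|_{t=1}\qquad\text{for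 all }a\in\mathcal{A}.$$
   Context: Ore extension: $\mathcal{A}[x;\sigma,\Delta]$ is the skew polynomial ring with $xa=\sigma(a)x+\Delta(a)$; $\sigma$-derivation means $\Delta(ab)=\sigma(a)\Delta(b)+\Delta(a)b$. $q$-integers: $(i)_q=q^{i-1}+\cdots+1$, $(i)!_q=(i)_q\cdots(1)_q$, $(0)!_q=1$. For an element $r$, both $\overline r$ and $r|_{t=1}$ denote its image modulo $t-1$; a fraction such as $\frac{r}{t-1}$ denotes the unique element $r'$ with $(t-1)r'=r$ (when it exists), and similarly for other nonzero denominators in $\mathbb{K}[t^{\pm1}]$. The semiclassical limit bracket on $R$ is $\{\overline r,\overline s\}=\frac{rs-sr}{t-1}\big|_{t=1}$ for $r,s\in\mathcal{R}$; it is a Poisson bracket. A Poisson derivation is a $\mathbb{K}$-derivation $\alpha$ with $\alpha(\{a,b\})=\{\alpha(a),b\}+\{a,\alpha(b)\}$. A Poisson $\alpha$-derivation is a $\mathbb{K}$-derivation $\delta$ with $\delta(\{a,b\})=\{\delta(a),b\}+\{a,\delta(b)\}+\alpha(a)\delta(b)-\delta(a)\alpha(b)$. The Poisson-Ore extension $A[X;\alpha,\delta]_P$ is $A[X]$ with the unique Poisson bracket extending that of $A$ with $\{X,a\}=\alpha(a)X+\delta(a)$. A higher derivation on $A$ is a sequence $(D_i)_{i\ge0}$ of $\mathbb{K}$-linear maps $A\to A$ with $D_0=\mathrm{id}_A$ and $D_n(ab)=\sum_{i=0}^nD_i(a)D_{n-i}(b)$. It is iterative if $D_iD_j=\binom{i+j}{i}D_{i+j}$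 for all $i,j$, and locally nilpotent if for each $a\in A$ there is $n\ge0$ with $D_i(a)=0$ for all $i\ge n$. It is a higher $(\eta,\alpha)$-skew Poisson derivation if moreover for all $a,b\in A$, $n\ge0$, $$D_n(\{a,b\})=\sum_{i=0}^n\Big(\{D_i(a),D_{n-i}(b)\}+i\big(\alpha D_{n-i}(a)D_i(b)-D_i(a)\,\alpha D_{n-i}(b)\big)\Big)$$ and $D_i\alpha=\alpha D_i+i\eta D_i$ for all $i\ge0$. ''$\delta$ extends to $(D_i)$'' means $D_1=\delta$. $\Delta$ is locally nilpotent if for every $a\in\mathcal{A}$ some power $\Delta^n$ kills $a$. *)

(* Defs.v *)
From HB Require Import structures.
From mathcomp Require Import all_boot all_order all_algebra.
From mathcomp Require Import boolp classical_sets.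

Set Implicit Arguments.
Unset Strict Implicit.
Unset Printing Implicit Defensive.

Import GRing.Theory.
Local Open Scope ring_scope.
Local Open Scope quotient_scope.

(* Algebras given by a central structure map, over which linearity is          *)
(* expressed. MathComp's algType excludes the zero ring, which must be        *)
(* allowed for A / (t - 1)A: it occurs when t - 1 is invertible in A, and     *)
(* this is compatible with A being torsion free.                              *)

HB.mixin Record PzRing_isPzAlgebra (K : pzRingType) B of GRing.PzRing B := {
  algmap : K -> B;
  algmap_zmod_morphism : zmod_morphism algmap;
  algmap_monoid_morphism : monoid_morphism algmap;
  algmapC : forall k b, algmap k * b = b * algmap k
}.

#[short(type="pzAlgType")]
HB.structure Definition PzAlgebra (K : pzRingType) :=
  {B of GRing.PzRing B & PzRing_isPzAlgebra K B}.

(* The ring K[t, t^-1], as the subring of K(t) of fractions p / t^n.          *)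

Section Laurent.
Variable K : fieldType.

Definition is_laurent (f : {fraction {poly K}}) : bool :=
  `[< exists (p : {poly K}) (n : nat),
        f = FracField.tofrac p / FracField.tofrac 'X ^+ n >].

Let X := FracField.tofrac ('X : {poly K}).

Let X_neq0 n : X ^+ n != 0.
Proof. by rewrite expf_neq0 // tofrac_eq0 polyX_eq0. Qed.

Let is_laurent_subring : subring_closed is_laurent.
Proof.
split.
- by apply/asboolP; exists 1, 0%N; rewrite tofrac1 expr0 divr1.
- move=> _ _ /asboolP[p [m ->]] /asboolP[q [n ->]]; apply/asboolP.
  exists (p * 'X^n - q * 'X^m), (m + n)%N.
  rewrite tofracB !tofracM !tofracXn exprD mulrBl.
  by rewrite -(mulf_div _ _ (X ^+ n)) divff // mulr1 [X ^+ m * _]mulrC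
             -(mulf_div _ _ (X ^+ m)) divff // mulr1.
- move=> _ _ /asboolP[p [m ->]] /asboolP[q [n ->]]; apply/asboolP.
  by exists (p * q), (m + n)%N; rewrite tofracM exprD mulf_div.
Qed.

HB.instance Definition _ :=
  GRing.isSubringClosed.Build {fraction {poly K}} is_laurent
    is_laurent_subring.

Record laurent := Laurent {
  laurent_val : {fraction {poly K}};
  laurent_valP : laurent_val \in is_laurent }.

HB.instance Definition _ := [isSub for laurent_val].
HB.instance Definition _ := [Choice of laurent by <:].
HB.instance Definition _ := [SubChoice_isSubComNzRing of laurent by <:].

Definition laurent_unit : pred laurent := fun f => `[< exists g, g * f = 1 >].
Definition laurent_inv (f : laurent) : laurent :=
  if laurent_unit f then xget 0 [set g | g * f = 1]%classic else f.

Let laurent_mulV : {in laurent_unit, left_inverse 1 laurent_inv *%R}.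
Proof.
move=> f fU; rewrite /laurent_inv; have -> : laurent_unit f by [].
by case: xgetP => [g _ //|]; case/asboolP: fU => g gf /(_ g).
Qed.

Let laurent_unitPl (f g : laurent) : g * f = 1 -> laurent_unit f.
Proof. by move=> gf; apply/asboolP; exists g. Qed.

Let laurent_inv_out : {in [predC laurent_unit], laurent_inv =1 id}.
Proof. by move=> f /negbTE; rewrite /laurent_inv -topredE /= => ->. Qed.

HB.instance Definition _ := GRing.ComNzRing_hasMulInverse.Build laurent
  laurent_mulV laurent_unitPl laurent_inv_out.

Let laurent_idomain (f g : laurent) : f * g = 0 -> (f == 0) || (g == 0).
Proof.
move/(congr1 val); rewrite rmorphM rmorph0 => /eqP.
by rewrite mulf_eq0 -!val_eqE.
Qed.

HB.instance Definition _ :=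
  GRing.ComUnitRing_isIntegral.Build laurent laurent_idomain.

Let poly_laurent_subproof (p : {poly K}) : FracField.tofrac p \in is_laurent.
Proof. by apply/asboolP; exists p, 0%N; rewrite expr0 divr1. Qed.

Definition poly_laurent (p : {poly K}) : laurent :=
  Laurent (poly_laurent_subproof p).

Let poly_laurent_zmod : zmod_morphism poly_laurent.
Proof. by move=> p q; apply: val_inj; rewrite /= tofracB. Qed.

Let poly_laurent_monoid : monoid_morphism poly_laurent.
Proof.
by split=> [|p q]; apply: val_inj; rewrite /= ?tofrac1 // tofracM.
Qed.

HB.instance Definition _ := GRing.isZmodMorphism.Build {poly K} laurent
  poly_laurent poly_laurent_zmod.
HB.instance Definition _ := GRing.isMonoidMorphism.Build {poly K} laurent
  poly_laurent poly_laurent_monoid.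

Definition lconst (k : K) : laurent := poly_laurent k%:P.
Definition tvar : laurent := poly_laurent 'X.

Lemma poly_laurent_inj : injective poly_laurent.
Proof. by move=> p q /(congr1 val) /= /eqP; rewrite tofrac_eq => /eqP. Qed.

Lemma tvar_unit : tvar \is a GRing.unit.
Proof.
apply/asboolP; have inU : (X ^+ 1)^-1 \in is_laurent.
  by apply/asboolP; exists 1, 1%N; rewrite tofrac1 mul1r.
by exists (Laurent inU); apply: val_inj; rewrite /= expr1 mulVf // -[X]expr1.
Qed.

Lemma tvarB1_neq0 : tvar - 1 != 0.
Proof.
have -> : tvar - 1 = poly_laurent ('X - 1%:P) by rewrite rmorphB rmorph1.
by rewrite -(rmorph0 poly_laurent) (inj_eq poly_laurent_inj) polyXsubC_eq0.
Qed.

End Laurent.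

Arguments tvar {K}.
Arguments lconst {K} k.

Definition torsion_free (K : fieldType) (M : lmodType (laurent K)) :=
  forall (c : laurent K) (m : M), c *: m = 0 -> c = 0 \/ m = 0.

(* is_frac r c r' : the fraction r / c exists in M and equals r'. *)
Definition is_frac (L : pzRingType) (M : lmodType L) (r : M) (c : L) (r' : M) :=
  unique (fun s : M => c *: s = r) r'.

(* The K-algebra M / (t - 1)M.                                                *)

Section SpecializationAtOne.
Variables (K : fieldType) (M : algType (laurent K)).

Local Notation t1 := (tvar - 1 : laurent K).

Definition eqmod_t1 (a b : M) : bool := `[< exists c, a - b = t1 *: c >].

Let eqmod_t1_refl : reflexive eqmod_t1.
Proof. by move=> a; apply/asboolP; exists 0; rewrite subrr scaler0. Qed.

Let eqmod_t1_sym : symmetric eqmod_t1.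
Proof.
suff h a b : eqmod_t1 a b -> eqmod_t1 b a by move=> a b; apply/idP/idP; apply: h.
case/asboolP=> c e; apply/asboolP; exists (- c).
by rewrite scalerN -e opprB.
Qed.

Let eqmod_t1_trans : transitive eqmod_t1.
Proof.
move=> b a c /asboolP[d e] /asboolP[d' e']; apply/asboolP; exists (d + d').
by rewrite scalerDr -e -e' addrA subrK.
Qed.

Canonical eqmod_t1_equiv :=
  EquivRel eqmod_t1 eqmod_t1_refl eqmod_t1_sym eqmod_t1_trans.

Definition modt1 := {eq_quot eqmod_t1}.
HB.instance Definition _ := EqQuotient.on modt1.
HB.instance Definition _ := Choice.on modt1.

Definition bar (a : M) : modt1 := \pi_modt1 a.

Lemma bar_eqP a b : bar a = bar b <-> exists c, a - b = t1 *: c.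
Proof. by split=> [/eqmodP/asboolP|h]; last by apply/eqmodP/asboolP. Qed.

Lemma bar_surj u : exists a, u = bar a.
Proof. by exists (repr u); rewrite /bar reprK. Qed.

Let add (u v : modt1) := bar (repr u + repr v).
Let opp (u : modt1) := bar (- repr u).
Let mul (u v : modt1) := bar (repr u * repr v).

Let repr_bar a : exists c, repr (bar a) = a + t1 *: c.
Proof.
have /bar_eqP[c e] : bar (repr (bar a)) = bar a by rewrite /bar reprK.
by exists c; rewrite -e addrC subrK.
Qed.

Let addE a b : add (bar a) (bar b) = bar (a + b).
Proof.
rewrite /add; have [c ->] := repr_bar a; have [d ->] := repr_bar b.
apply/bar_eqP; exists (c + d).
by rewrite addrACA [_ + (_ + t1 *: d)]addrC addrK scalerDr.
Qed.

Let oppE a : opp (bar a) = bar (- a).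
Proof.
rewrite /opp; have [c ->] := repr_bar a; apply/bar_eqP; exists (- c).
by rewrite opprK opprD addrAC addNr add0r scalerN.
Qed.

Let mulE a b : mul (bar a) (bar b) = bar (a * b).
Proof.
rewrite /mul; have [c ->] := repr_bar a; have [d ->] := repr_bar b.
apply/bar_eqP; exists (c * (b + t1 *: d) + a * d).
rewrite scalerDr scalerAl scalerAr mulrDl [a * (b + _)]mulrDr.
by rewrite addrAC [a * b + _ - _]addrAC subrr add0r addrC.
Qed.

Let addA : associative add.
Proof.
move=> u v w; have [a ->] := bar_surj u; have [b ->] := bar_surj v.
have [c ->] := bar_surj w.
by rewrite !addE addrA.
Qed.
Let addC : commutative add.
Proof.
move=> u v; have [a ->] := bar_surj u; have [b ->] := bar_surj v.
by rewrite !addE addrC.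
Qed.
Let add0 : left_id (bar 0) add.
Proof. by move=> u; have [a ->] := bar_surj u; rewrite addE add0r. Qed.
Let addN : left_inverse (bar 0) opp add.
Proof. by move=> u; have [a ->] := bar_surj u; rewrite oppE addE addNr. Qed.

HB.instance Definition _ := GRing.isZmodule.Build modt1 addA addC add0 addN.

Let barD a b : bar a + bar b = bar (a + b). Proof. exact: addE. Qed.

Let mulA : associative mul.
Proof.
move=> u v w; have [a ->] := bar_surj u; have [b ->] := bar_surj v.
have [c ->] := bar_surj w.
by rewrite !mulE mulrA.
Qed.
Let mul1 : left_id (bar 1) mul.
Proof. by move=> u; have [a ->] := bar_surj u; rewrite mulE mul1r. Qed.
Let mulr1_ : right_id (bar 1) mul.
Proof. by move=> u; have [a ->] := bar_surj u; rewrite mulE mulr1. Qed.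
Let mulDl : left_distributive mul +%R.
Proof.
move=> u v w; have [a ->] := bar_surj u; have [b ->] := bar_surj v.
have [c ->] := bar_surj w.
by rewrite !(barD, mulE) mulrDl.
Qed.
Let mulDr : right_distributive mul +%R.
Proof.
move=> u v w; have [a ->] := bar_surj u; have [b ->] := bar_surj v.
have [c ->] := bar_surj w.
by rewrite !(barD, mulE) mulrDr.
Qed.

HB.instance Definition _ := GRing.Zmodule_isPzRing.Build modt1
  mulA mul1 mulr1_ mulDl mulDr.

Let bar_zmod : zmod_morphism bar.
Proof. by move=> a b; rewrite -barD -oppE. Qed.
Let bar_monoid : monoid_morphism bar.
Proof. by split=> // a b; rewrite -mulE. Qed.

HB.instance Definition _ := GRing.isZmodMorphism.Build M modt1 bar bar_zmod.
HB.instance Definition _ := GRing.isMonoidMorphism.Build M modt1 bar bar_monoid.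

Definition modt1_algmap (k : K) : modt1 := bar (lconst k)%:A.

Let algmap_zmod : zmod_morphism modt1_algmap.
Proof.
move=> a b; rewrite -(rmorphB bar); congr bar.
by rewrite -scalerBl /lconst polyCB rmorphB.
Qed.
Let algmap_monoid : monoid_morphism modt1_algmap.
Proof.
split=> [|a b]; first by rewrite /modt1_algmap /lconst rmorph1 scale1r.
rewrite -(rmorphM bar); congr bar.
by rewrite -scalerAl mul1r scalerA /lconst polyCM rmorphM.
Qed.
Let algmapC k u : modt1_algmap k * u = u * modt1_algmap k.
Proof.
have [a ->] := bar_surj u; rewrite -!(rmorphM bar); congr bar.
by rewrite -scalerAl -scalerAr mul1r mulr1.
Qed.

HB.instance Definition _ := PzRing_isPzAlgebra.Build K modt1
  algmap_zmod algmap_monoid algmapC.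

Lemma bar_lconst k (a : M) : bar (lconst k *: a) = algmap k * bar a.
Proof. by rewrite -(rmorphM bar) -scalerAl mul1r. Qed.

(* The semiclassical limit bracket; it is only meaningful when M is torsion   *)
(* free and modt1 is commutative, see scl_bracketE.                           *)
Definition scl_bracket (u v : modt1) : modt1 :=
  xget 0 [set w | exists r s q,
    [/\ u = bar r, v = bar s, is_frac (r * s - s * r) t1 q & w = bar q]]%classic.

Lemma torsion_free_frac (r : M) (c : laurent K) (q : M) :
  torsion_free M -> c != 0 -> c *: q = r -> is_frac r c q.
Proof.
move=> tf c0 e; split=> // q' e'; apply/eqP; rewrite -subr_eq0.
have /tf[c00|->] // : c *: (q - q') = 0 by rewrite scalerBr e e' subrr.
by rewrite c00 eqxx in c0.
Qed.

Lemma scl_bracketE : torsion_free M -> commutative (@GRing.mul modt1) ->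
  forall r s : M, exists2 q, is_frac (r * s - s * r) t1 q
                       & scl_bracket (bar r) (bar s) = bar q.
Proof.
move=> tf mC.
have fracP (r s : M) : exists q, is_frac (r * s - s * r) t1 q.
  have /bar_eqP[q e] : bar (r * s) = bar (s * r) by rewrite !rmorphM mC.
  by exists q; apply: torsion_free_frac => //; apply: tvarB1_neq0.
move=> r s; have [q qP] := fracP r s; exists q => //.
rewrite /scl_bracket; case: xgetP => [w _|]; last first.
  by move/(_ (bar q)); case; exists r, s, q.
case=> r' [s' [q' [/bar_eqP[c ec] /bar_eqP[d ed] [e' _] ->]]].
case: qP => e _.
have er : r = r' + t1 *: c by rewrite -ec addrC subrK.
have es : s = s' + t1 *: d by rewrite -ed addrC subrK.
have eq : t1 *: (q - (q' + ((r' * d - d * r') + (c * s - s * c)))) = 0.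
  rewrite scalerBr !(scalerDr, scalerN) e e'.
  rewrite (scalerAr _ r' d) (scalerAl _ d r') (scalerAl _ c s) (scalerAr _ s c).
  apply/eqP; rewrite subr_eq0; apply/eqP.
  set X := t1 *: c in er *; set Y := t1 *: d in es *.
  rewrite addrA [_ - _ + (_ - _)]addrACA -opprD -mulrDr -mulrDl -es.
  by rewrite addrACA -opprD -mulrDl -mulrDr -er.
have [t10|/eqP] := tf _ _ eq; first by have := tvarB1_neq0 K; rewrite t10 eqxx.
rewrite subr_eq0 => /eqP ->.
rewrite !(rmorphD, rmorphN, rmorphM) /=.
by rewrite (mC (bar d)) (mC (bar s)) !subrr !addr0.
Qed.

End SpecializationAtOne.

Arguments bar {K M} a.
Arguments scl_bracket {K M} u v.

Section OreExtensions.

(* B is a free left A-module, via iota, with basis 1, x, x^2, ...             *)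
Definition basis_powers (A B : pzRingType) (iota : A -> B) (x : B) :=
  (forall b : B, exists (n : nat) (c : nat -> A),
     b = \sum_(i < n) iota (c i) * x ^+ i) /\
  (forall (n : nat) (c : nat -> A),
     \sum_(i < n) iota (c i) * x ^+ i = 0 -> forall i, (i < n)%N -> c i = 0).

Definition skew_derivation (A : pzRingType) (sigma Delta : A -> A) :=
  forall a b, Delta (a * b) = sigma a * Delta b + Delta a * b.

(* B = A[x; sigma, Delta], with A embedded in B by iota. *)
Definition ore_extension (A B : pzRingType) (iota : A -> B) (x : B)
    (sigma Delta : A -> A) :=
  basis_powers iota x /\
  (forall a, x * iota a = iota (sigma a) * x + iota (Delta a)).

End OreExtensions.

Section PoissonAlgebras.
Variable K : fieldType.

Definition klinear (A B : pzAlgType K) (f : A -> B) :=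
  zmod_morphism f /\ (forall k a, f (algmap k * a) = algmap k * f a).

Definition derivation (A : pzAlgType K) (d : A -> A) :=
  klinear d /\ (forall a b, d (a * b) = d a * b + a * d b).

Definition poisson_bracket (A : pzAlgType K) (br : A -> A -> A) :=
  [/\ commutative (@GRing.mul A),
      (forall a, derivation (br a)),
      (forall b, derivation (br^~ b)),
      (forall a, br a a = 0)
    & (forall a b c, br a (br b c) + br b (br c a) + br c (br a b) = 0)].

Definition poisson_derivation (A : pzAlgType K) (br : A -> A -> A)
    (alpha : A -> A) :=
  derivation alpha /\
  (forall a b, alpha (br a b) = br (alpha a) b + br a (alpha b)).

Definition poisson_skew_derivation (A : pzAlgType K) (br : A -> A -> A)
    (alpha delta : A -> A) :=
  derivation delta /\
  (forall a b, delta (br a b) = br (delta a) b + br a (delta b)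
                              + alpha a * delta b - delta a * alpha b).

(* B = A[X; alpha, delta]_P, with A embedded in B by iota. *)
Definition poisson_ore_extension (A B : pzAlgType K)
    (brA : A -> A -> A) (brB : B -> B -> B) (iota : A -> B) (X : B)
    (alpha delta : A -> A) :=
  [/\ poisson_bracket brA /\ poisson_bracket brB,
      poisson_derivation brA alpha /\ poisson_skew_derivation brA alpha delta,
      klinear iota /\ monoid_morphism iota,
      basis_powers iota X
    & (forall a b, iota (brA a b) = brB (iota a) (iota b)) /\
      (forall a, brB X (iota a) = iota (alpha a) * X + iota (delta a))].

Definition higher_derivation (A : pzAlgType K) (D : nat -> A -> A) :=
  [/\ (forall n, klinear (D n)), D 0%N =1 id
    & forall n a b, D n (a * b) = \sum_(i < n.+1) D i a * D (n - i)%N b].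

Definition iterative (A : pzAlgType K) (D : nat -> A -> A) :=
  forall i j a, D i (D j a) = D (i + j)%N a *+ 'C(i + j, i).

Definition higher_locally_nilpotent (A : pzAlgType K) (D : nat -> A -> A) :=
  forall a, exists n, forall i, (n <= i)%N -> D i a = 0.

Definition higher_skew_poisson_derivation (A : pzAlgType K)
    (br : A -> A -> A) (eta : K) (alpha : A -> A) (D : nat -> A -> A) :=
  [/\ higher_derivation D,
      (forall n a b, D n (br a b) =
         \sum_(i < n.+1)
           (br (D i a) (D (n - i)%N b)
            + (alpha (D (n - i)%N a) * D i b
               - D i a * alpha (D (n - i)%N b)) *+ i))
    & (forall i a, D i (alpha a) =
         alpha (D i a) + algmap (i%:R * eta) * D i a)].

End PoissonAlgebras.

Definition locally_nilpotent (A : nmodType) (f : A -> A) :=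
  forall a, exists n, iter n f a = 0.

Definition qint (L : pzRingType) (q : L) (i : nat) : L := \sum_(j < i) q ^+ j.
Definition qfact (L : pzRingType) (q : L) (i : nat) : L :=
  \prod_(j < i) qint q j.+1.

(* Main.v *)
(** Every operator on A / (t - 1)A is the reduction of an operator on A obtained
    by exact division, which is unique by torsion freeness; so each identity is
    proved in A, after multiplying by the denominators, and then reduced.
    Writing D_i for Delta^i / ((t - 1)^i (i)!_q) with q = t^eta, the key
    identities in A are
      D_n(ab) = sum_i sigma^(n-i)(D_i a) D_(n-i) b,
      D_i D_j = [i+j choose i]_q D_(i+j),
      D_i((sigma - 1)/(t - 1)) = ((sigma - 1)/(t - 1)) D_i
                                 + (q^i - 1)/(t - 1) sigma D_i.
    At t = 1, sigma becomes the identity, (sigma^k - 1)/(t - 1) becomes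
    k alpha, Gaussian binomials become binomials, and (q^i - 1)/(t - 1) becomes
    i eta. *)

Require Import Defs.
From HB Require Import structures.
From mathcomp Require Import all_boot all_order all_algebra.
From mathcomp Require Import ring boolp.

Set Implicit Arguments.
Unset Strict Implicit.
Unset Printing Implicit Defensive.

Import GRing.Theory.
Local Open Scope ring_scope.

Local Notation t1 := (tvar - 1).

(** * Reduction of linear maps modulo [t - 1] *)

Section Specialization.
Variables (K : fieldType) (M N : algType (laurent K)).

Lemma bar_t1 (a : M) : bar (t1 *: a) = 0.
Proof. by rewrite -(rmorph0 bar); apply/bar_eqP; exists a; rewrite subr0. Qed.

Lemma bar_eq0 (a : M) : bar a = 0 -> exists b, a = t1 *: b.
Proof.
by rewrite -(rmorph0 bar) => /bar_eqP[b e]; exists b; rewrite -e subr0.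
Qed.

(** The representative is arbitrary, so this makes sense for any function; for a linear [f] the
    choice is immaterial, because [f] maps multiples of [t - 1] to multiples of [t - 1]. *)
Definition modt1_map (f : M -> N) (u : modt1 M) : modt1 N := bar (f (repr u)).

Lemma modt1_mapE (f : {linear M -> N}) a : modt1_map f (bar a) = bar (f a).
Proof.
have /bar_eqP[c e] : bar (repr (bar a)) = bar a.
  by have [b ->] := bar_surj (bar a); rewrite /bar reprK.
by apply/bar_eqP; exists (f c); rewrite -linearB e linearZ.
Qed.

Lemma modt1_map_klinear (f : {linear M -> N}) : klinear (modt1_map f).
Proof.
split=> [u v|k u].
  have [a ->] := bar_surj u; have [b ->] := bar_surj v.
  by rewrite -rmorphB !modt1_mapE linearB rmorphB.
by have [a ->] := bar_surj u; rewrite -bar_lconst !modt1_mapE linearZ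
  bar_lconst.
Qed.

Lemma modt1_map_monoid (f : {lrmorphism M -> N}) :
  monoid_morphism (modt1_map f).
Proof.
split=> [|u v].
  by rewrite -(rmorph1 bar) modt1_mapE rmorph1 rmorph1.
have [a ->] := bar_surj u; have [b ->] := bar_surj v.
by rewrite -rmorphM !modt1_mapE rmorphM rmorphM.
Qed.

End Specialization.

(** * Exact division and the semiclassical Poisson bracket *)

Section TorsionFree.
Variables (K : fieldType) (M : algType (laurent K)).
Hypothesis M_tf : torsion_free M.

Lemma torsion_free_scalerI (c : laurent K) :
  c != 0 -> injective (fun a : M => c *: a).
Proof.
move=> c0 a b /= e; have /M_tf[c00|/eqP] : c *: (a - b) = 0.
- by rewrite scalerBr e subrr.
- by rewrite c00 eqxx in c0.
- by rewrite subr_eq0 => /eqP.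
Qed.

(** Quotients by [c] are picked by choice; they depend linearly on [a] because multiplication by [c]
    is injective. *)
Lemma linear_quotient (f : {linear M -> M}) (c : laurent K) :
    c != 0 -> (forall a, exists b, f a = c *: b) ->
  exists g : {linear M -> M}, forall a, c *: g a = f a.
Proof.
move=> c0 /choice[g gE].
have g_linear : linear g.
  move=> k a b; apply: (torsion_free_scalerI c0).
  by rewrite /= -gE linearP !gE scalerDr !scalerA mulrC.
pose gL := GRing.isLinear.Build _ _ _ _ g g_linear.
pose g' : {linear M -> M} := HB.pack g gL.
by exists g'.
Qed.

(** Lifts the bracket to an operation on [M] itself, so that Poisson identities can be checked there
    after multiplying by [t - 1]. *)
Lemma commutator_quotient : commutative (@GRing.mul (modt1 M)) ->
  exists cm : M -> M -> M,
    (forall a b, t1 *: cm a b = a * b - b * a) /\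
    (forall a b, scl_bracket (bar a) (bar b) = bar (cm a b)).
Proof.
move=> mC; have h (a b : M) : exists q,
    t1 *: q = a * b - b * a /\ scl_bracket (bar a) (bar b) = bar q.
  by have [q [e _] e'] := scl_bracketE M_tf mC a b; exists q.
exists (fun a => projT1 (choice (h a))).
by split=> a b; case: (projT2 (choice (h a)) b).
Qed.

Section Commutator.
Variable cm : M -> M -> M.
Hypothesis cmE : forall a b, t1 *: cm a b = a * b - b * a.

Let t1I : injective (fun a : M => t1 *: a).
Proof. exact/torsion_free_scalerI/tvarB1_neq0. Qed.

Lemma cm_anti a b : cm b a = - cm a b.
Proof. by apply: t1I; rewrite scalerN !cmE opprB. Qed.

Lemma cm_id a : cm a a = 0.
Proof. by apply: t1I; rewrite cmE scaler0 subrr. Qed.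

Lemma cm_linear a : linear (cm a).
Proof.
move=> k b c; apply: t1I => /=; rewrite scalerDr scalerA mulrC -scalerA !cmE.
by rewrite mulrDl mulrDr scalerBr scalerAr scalerAl opprD addrACA.
Qed.

Lemma cmB a b c : cm a (b - c) = cm a b - cm a c.
Proof. by rewrite addrC -scaleN1r cm_linear scaleN1r addrC. Qed.

Lemma cmZ a k b : cm a (k *: b) = k *: cm a b.
Proof.
have cm0 : cm a 0 = 0 by rewrite -{1}(subrr 0) cmB subrr.
by have := cm_linear a k b 0; rewrite addr0 cm0 addr0.
Qed.

Lemma cmN a b : cm a (- b) = - cm a b.
Proof. by rewrite -scaleN1r cmZ scaleN1r. Qed.

Lemma cmM a b c : cm a (b * c) = cm a b * c + b * cm a c.
Proof.
apply: t1I; rewrite /= scalerDr scalerAl scalerAr !cmE.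
by rewrite mulrBl mulrBr !mulrA addrA subrK.
Qed.

(** One factor [t - 1] is enough: moved inside, it turns [cm b c] into [b * c - c * b], and the
    Leibniz rule for [cm a] applies. *)
Lemma cm_jacobi a b c : cm a (cm b c) = cm (cm a b) c + cm b (cm a c).
Proof.
apply: t1I; rewrite /= -cmZ cmE cmB !cmM scalerDr !cmE opprD.
by rewrite [- (cm a c * b) - _]addrC addrACA.
Qed.

End Commutator.

Lemma scl_bracket_poisson : commutative (@GRing.mul (modt1 M)) ->
  poisson_bracket (@scl_bracket K M).
Proof.
move=> mC; have [cm [cmE brE]] := commutator_quotient mC.
have anti u v : scl_bracket v u = - scl_bracket u v :> modt1 M.
  have [a ->] := bar_surj u; have [b ->] := bar_surj v.
  by rewrite !brE (cm_anti cmE) rmorphN.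
have der u : derivation (@scl_bracket K M u).
  have [a ->] := bar_surj u; split; first split.
  - move=> v w; have [b ->] := bar_surj v; have [c ->] := bar_surj w.
    by rewrite -rmorphB !brE (cmB cmE) rmorphB.
  - move=> k v; have [b ->] := bar_surj v.
    by rewrite -bar_lconst !brE (cmZ cmE) bar_lconst.
  - move=> v w; have [b ->] := bar_surj v; have [c ->] := bar_surj w.
    by rewrite -rmorphM !brE (cmM cmE) rmorphD !rmorphM.
split=> //.
(* Antisymmetry transfers the derivation property to the first argument. *)
- move=> w; split; first split.
  + move=> u v; rewrite !(anti w); have [[-> _] _] := der w.
    by rewrite opprB opprK addrC.
  + move=> k u; rewrite !(anti w); have [[_ ->] _] := der w.
    by rewrite mulrN.
  + move=> u v; rewrite !(anti w); have [_ ->] := der w.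
    by rewrite opprD mulNr mulrN.
- by move=> u; have [a ->] := bar_surj u; rewrite brE (cm_id cmE) rmorph0.
- move=> u v w; have [a ->] := bar_surj u; have [b ->] := bar_surj v.
  have [c ->] := bar_surj w; rewrite !brE (cm_jacobi cmE a b c).
  rewrite (cm_anti cmE a c) (cm_anti cmE (cm a b) c).
  by rewrite (cmN cmE) rmorphD !rmorphN addrK subrr.
Qed.

End TorsionFree.

(** * Power bases and their reduction modulo [t - 1] *)

Section PowerBasis.
Variables (K : fieldType) (A R : algType (laurent K)).
Variables (iota : {lrmorphism A -> R}) (x : R).
Hypothesis basis : basis_powers iota x.

Lemma basis_powers_torsion_free : torsion_free A -> torsion_free R.
Proof.
move=> A_tf c m cm0; have [->|c0] := eqVneq c 0; [by left | right].
have [[n [f mE]] free] := (basis.1 m, basis.2).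
have cf0 : forall i, (i < n)%N -> c *: f i = 0.
  apply: free; rewrite -[RHS]cm0 mE scaler_sumr; apply: eq_bigr => i _.
  by rewrite linearZ scalerAl.
rewrite mE big1 // => i _; have [c00|->] := A_tf _ _ (cf0 i (ltn_ord i)).
  by rewrite c00 eqxx in c0.
by rewrite rmorph0 mul0r.
Qed.

(** The sum equals [t - 1] times some element; expanding that element in the basis and comparing
    coefficients makes each [f i] a multiple of [t - 1]. *)
Lemma basis_powers_bar0 n (f : nat -> A) :
    bar (\sum_(i < n) iota (f i) * x ^+ i) = 0 ->
  forall i, (i < n)%N -> bar (f i) = 0.
Proof.
(* The two expansions may differ in length, so both are padded with zeros to length [m + n]. *)
have extend k l (g : nat -> A) : \sum_(i < k) iota (g i) * x ^+ i =
    \sum_(i < k + l) iota (if (i < k)%N then g i else 0) * x ^+ i.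
  rewrite (big_ord_widen (k + l) (fun i => iota (g i) * x ^+ i)) ?leq_addr //.
  rewrite big_mkcond; apply: eq_bigr => i _.
  by case: ifP; rewrite // rmorph0 mul0r.
case/bar_eq0=> r; have [m [g ->]] := basis.1 r.
rewrite (extend n m) (extend m n) addnC scaler_sumr => /eqP.
rewrite -subr_eq0 -sumrB => /eqP e i lt_in.
pose F j := if (j < n)%N then f j else 0.
pose G j := if (j < m)%N then g j else 0.
have h j : (j < m + n)%N -> F j - t1 *: G j = 0.
  apply: (basis.2 (m + n)%N (fun j => F j - t1 *: G j)); rewrite -[RHS]e.
  apply: eq_bigr => k _.
  by rewrite linearB mulrBl; congr (_ - _); rewrite linearZ scalerAl.
have /eqP := h i (ltn_addl m lt_in).
by rewrite /F lt_in subr_eq0 => /eqP ->; rewrite bar_t1.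
Qed.

Lemma modt1_basis_powers : basis_powers (modt1_map iota) (bar x).
Proof.
split=> [b|n c].
  have [r ->] := bar_surj b; have [n [f ->]] := basis.1 r.
  exists n, (fun i => bar (f i)); rewrite rmorph_sum.
  by apply: eq_bigr => i _; rewrite modt1_mapE rmorphM rmorphXn.
move=> e i lt_in; have [f cE] : exists f : nat -> A, forall i, c i = bar (f i).
  by exists (fun i => projT1 (cid (bar_surj (c i)))) => j; case: cid.
rewrite cE; apply: (basis_powers_bar0 (n := n)) lt_in; rewrite -{}e rmorph_sum.
by apply: eq_bigr => j _; rewrite cE modt1_mapE rmorphM rmorphXn.
Qed.

Lemma modt1_basis_inj (u : modt1 A) : modt1_map iota u = 0 -> u = 0.
Proof.
(* Injectivity is freeness for sums of length one. *)
move=> u0; apply: (modt1_basis_powers.2 1%N (fun=> u) _ 0%N) => //.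
by rewrite big_ord1 u0 mul0r.
Qed.

Lemma basis_powers_modt1_comm :
  commutative (@GRing.mul (modt1 R)) -> commutative (@GRing.mul (modt1 A)).
Proof.
move=> mC u v; have [a ->] := bar_surj u; have [b ->] := bar_surj v.
apply/eqP; rewrite -subr_eq0; apply/eqP/modt1_basis_inj.
rewrite -!rmorphM -rmorphB modt1_mapE rmorphB !rmorphM rmorphB !rmorphM.
by rewrite mC subrr.
Qed.

(** The commutator of [x] and [a] is [(sigma a - a) x + Delta a]. It vanishes modulo [t - 1] by
    commutativity, hence so do its two coefficients. *)
Lemma ore_extension_divisible (sigma Delta : A -> A) :
    ore_extension iota x sigma Delta ->
    commutative (@GRing.mul (modt1 R)) -> forall a,
  (exists b, sigma a - a = t1 *: b) /\ (exists b, Delta a = t1 *: b).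
Proof.
move=> [_ oreE] mC a.
pose f i := if i == 0%N then Delta a else sigma a - a.
suff h i : (i < 2)%N -> bar (f i) = 0.
  by split; apply: bar_eq0; [exact: (h 1%N) | exact: (h 0%N)].
apply: basis_powers_bar0; rewrite !big_ord_recr big_ord0 /= add0r /f /=.
rewrite expr0 mulr1 expr1 rmorphB mulrBl addrC.
have -> : iota (sigma a) * x - iota a * x + iota (Delta a)
        = x * iota a - iota a * x.
  by rewrite oreE addrAC.
by rewrite rmorphB !rmorphM mC subrr.
Qed.

End PowerBasis.

(** * The maps alpha and delta and the Poisson-Ore extension *)

Section SemiclassicalLimit.
Variables (K : fieldType) (A : algType (laurent K)).
Hypothesis A_tf : torsion_free A.
Hypothesis A_comm : commutative (@GRing.mul (modt1 A)).
Variables (sigma : {lrmorphism A -> A}) (Delta : {linear A -> A}).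
Hypothesis Delta_skew : skew_derivation sigma Delta.
Variables s d : {linear A -> A}.
Hypothesis sE : forall a, t1 *: s a = sigma a - a.
Hypothesis dE : forall a, t1 *: d a = Delta a.

Let t1I : injective (fun a : A => t1 *: a).
Proof. exact/torsion_free_scalerI/tvarB1_neq0. Qed.

Lemma sigmaE a : sigma a = t1 *: s a + a.
Proof. by rewrite sE subrK. Qed.

Lemma bar_sigma a : bar (sigma a) = bar a.
Proof. by rewrite sigmaE rmorphD /= bar_t1 add0r. Qed.

Lemma sigma_quotientM a b : s (a * b) = s a * sigma b + a * s b.
Proof.
apply: t1I; rewrite /= scalerDr scalerAl scalerAr !sE rmorphM mulrBl mulrBr.
by rewrite addrA subrK.
Qed.

(** The twist can sit on either factor. Using one form for [a * b] and the other for [b * a] lets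
    the terms of [sigma_quotient_cm] regroup into commutators. *)
Lemma sigma_quotientMr a b : s (a * b) = sigma a * s b + s a * b.
Proof.
apply: t1I; rewrite /= scalerDr scalerAr scalerAl !sE rmorphM mulrBl mulrBr.
by rewrite addrA subrK.
Qed.

Lemma Delta_quotientM a b : d (a * b) = sigma a * d b + d a * b.
Proof. by apply: t1I; rewrite /= scalerDr scalerAr scalerAl !dE Delta_skew. Qed.

Section Commutator.
Variable cm : A -> A -> A.
Hypothesis cmE : forall a b, t1 *: cm a b = a * b - b * a.

Lemma sigma_quotient_cm a b : s (cm a b) = cm (s a) (sigma b) + cm a (s b).
Proof.
apply: t1I; rewrite /= -linearZ cmE linearB (sigma_quotientM a)
  sigma_quotientMr scalerDr !cmE opprD.
by rewrite addrACA.
Qed.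

Lemma Delta_quotient_cm a b :
  d (cm a b) = cm (d a) b + cm a (d b) + s a * d b - s b * d a.
Proof.
apply: t1I; rewrite /= -linearZ cmE linearB !Delta_quotientM scalerBr !scalerDr.
rewrite !scalerAl !cmE !sE !mulrBl.
rewrite !opprD !opprK.
(* The permutation places [a * d b] and [b * d a] next to their opposites. *)
rewrite [RHS](AC (2*2*2*2) ((5*1)*(7*4)*(3*6)*(8*2))).
by rewrite /= !subrr !addr0.
Qed.

End Commutator.

Lemma modt1_sigma_quotient_poisson :
  poisson_derivation (@scl_bracket K A) (modt1_map s).
Proof.
have [cm [cmE brE]] := commutator_quotient A_tf A_comm.
split; first split; first exact: modt1_map_klinear.
all: move=> u v; have [a ->] := bar_surj u; have [b ->] := bar_surj v.
  by rewrite -rmorphM !modt1_mapE sigma_quotientM rmorphD !rmorphM /= bar_sigma.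
(* The lifted identity pairs [s a] with [sigma b], which has the same class as [b]. *)
rewrite brE !modt1_mapE (sigma_quotient_cm cmE) -[bar b]bar_sigma !brE.
by rewrite rmorphD.
Qed.

Lemma modt1_Delta_quotient_poisson :
  poisson_skew_derivation (@scl_bracket K A) (modt1_map s) (modt1_map d).
Proof.
have [cm [cmE brE]] := commutator_quotient A_tf A_comm.
split; first split; first exact: modt1_map_klinear.
all: move=> u v; have [a ->] := bar_surj u; have [b ->] := bar_surj v.
  by rewrite -rmorphM !modt1_mapE Delta_quotientM rmorphD !rmorphM /=
    bar_sigma addrC.
rewrite brE !modt1_mapE (Delta_quotient_cm cmE) !brE.
by rewrite rmorphB !rmorphD !rmorphM (A_comm (bar (d a))).
Qed.

Lemma modt1_poisson_ore (R : algType (laurent K)) (iota : {lrmorphism A -> R})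
    (x : R) :
    ore_extension iota x sigma Delta -> commutative (@GRing.mul (modt1 R)) ->
  poisson_ore_extension (@scl_bracket K A) (@scl_bracket K R)
    (modt1_map iota) (bar x) (modt1_map s) (modt1_map d).
Proof.
move=> [basis oreE] R_comm.
have R_tf := basis_powers_torsion_free basis A_tf.
have [cm [cmE brE]] := commutator_quotient A_tf A_comm.
have [cmR [cmRE brRE]] := commutator_quotient R_tf R_comm.
have t1RI := torsion_free_scalerI R_tf (tvarB1_neq0 K).
split.
- by split; apply: scl_bracket_poisson.
- by split; [apply: modt1_sigma_quotient_poisson | apply:
  modt1_Delta_quotient_poisson].
- by split; [apply: modt1_map_klinear | apply: modt1_map_monoid].
- exact: modt1_basis_powers.
split=> [u v|u]; have [a ->] := bar_surj u.
  have [b ->] := bar_surj v; rewrite brE !modt1_mapE brRE; congr bar.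
  by apply: t1RI; rewrite /= cmRE -linearZ cmE rmorphB !rmorphM.
rewrite !modt1_mapE brRE.
(* This is the Ore relation with [iota a * x] subtracted, divided by [t - 1]. *)
have -> : cmR x (iota a) = iota (s a) * x + iota (d a).
  apply: t1RI; rewrite /= cmRE oreE sigmaE -dE linearD !linearZ mulrDl.
  by rewrite addrAC addrK scalerDr scalerAl.
by rewrite rmorphD rmorphM.
Qed.

End SemiclassicalLimit.

(** * Nonvanishing of q-integers and q-factorials *)

Section QIntegers.

Lemma qintD (L : pzRingType) (q : L) m n :
  qint q (m + n) = qint q m + q ^+ m * qint q n.
Proof.
rewrite /qint big_split_ord mulr_sumr; congr (_ + _).
by apply: eq_bigr => i _; rewrite exprD.
Qed.

Lemma qint1 (L : pzRingType) (q : L) : qint q 1 = 1.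
Proof. by rewrite /qint big_ord1 expr0. Qed.

Lemma qfactS (L : comPzRingType) (q : L) n :
  qfact q n.+1 = qint q n.+1 * qfact q n.
Proof. by rewrite /qfact big_ord_recr mulrC. Qed.

Variable K : fieldType.

Lemma tvar_expz_neq1 (m : int) : m != 0 -> tvar ^ m != 1 :> laurent K.
Proof.
have tvar_exp_neq1 n : tvar ^+ n.+1 != 1 :> laurent K.
  rewrite -(rmorphXn (@poly_laurent K)) -(rmorph1 (@poly_laurent K)).
  rewrite (inj_eq (@poly_laurent_inj K)); apply/eqP => /(congr1 (size \o val)).
  by rewrite /= size_polyXn size_poly1.
case: m => [[|n]|n] // _; first exact: tvar_exp_neq1.
by rewrite NegzE -exprz_inv -exprnP exprVn invr_eq1.
Qed.

(** In every characteristic, [(q - 1)] times this q-integer is [q ^+ n.+1 - 1], a power of [t] with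
    nonzero exponent minus 1. *)
Lemma qint_neq0 (eta : int) n :
  eta != 0 -> qint (tvar ^ eta : laurent K) n.+1 != 0.
Proof.
move=> eta0; have : tvar ^ (eta * n.+1%:Z) - 1 != 0 :> laurent K.
  by rewrite subr_eq0 tvar_expz_neq1 // mulf_neq0.
by rewrite -exprz_exp -exprnP subrX1 -/(qint _ _); apply: contraNneq => ->;
  rewrite mulr0.
Qed.

Lemma qfact_neq0 (eta : int) n :
  eta != 0 -> qfact (tvar ^ eta : laurent K) n != 0.
Proof.
move=> eta0; elim: n => [|n IHn]; first by rewrite /qfact big_ord0 oner_neq0.
by rewrite qfactS; apply: mulf_neq0; [apply: qint_neq0 | apply: IHn].
Qed.

End QIntegers.

(** * Laurent scalars at [t = 1] *)

Section ScalarsModT1.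
Variables (K : fieldType) (M : algType (laurent K)).
Implicit Types (a : M) (m : int).

Lemma bar_tvar_expz m a : bar (tvar ^ m *: a) = bar a.
Proof.
have tvar_exp n b : bar (tvar ^+ n *: b) = bar b :> modt1 M.
  elim: n => [|n IHn]; first by rewrite expr0 scale1r.
  rewrite exprS -scalerA -{1}[tvar](subrK 1) scalerDl scale1r rmorphD /=.
  by rewrite bar_t1 add0r.
case: m => n; first exact: tvar_exp.
(* A negative power is cancelled by [tvar ^+ n.+1], which leaves classes unchanged by the case
   already proved. *)
rewrite NegzE -exprnN -[LHS](tvar_exp n.+1) scalerA divrr ?scale1r //.
exact/unitrX/tvar_unit.
Qed.

Lemma bar_intr m a : bar (m%:~R *: a) = algmap (m%:~R : K) * bar a.
Proof. by rewrite -bar_lconst /lconst !rmorph_int. Qed.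

Lemma tvar_expz_quotient m : exists e : laurent K,
  t1 * e = tvar ^ m - 1 /\ forall a, bar (e *: a) = algmap (m%:~R : K) * bar a.
Proof.
have nat_case n : t1 * qint tvar n = tvar ^+ n - 1 :> laurent K /\
    forall a, bar (qint tvar n *: a) = bar a *+ n.
  split=> [|a]; first by rewrite subrX1.
  rewrite scaler_suml rmorph_sum -[n in RHS]card_ord -sumr_const.
  by apply: eq_bigr => i _; apply: (bar_tvar_expz i).
case: m => n; last first.
  (* The witness comes from t^(-k) - 1 = - t^(-k) (t^k - 1) with k = n + 1. *)
  have [e eE] := nat_case n.+1; exists (- (tvar ^ Negz n * qint tvar n.+1)).
  split=> [|a].
    rewrite mulrN mulrCA e NegzE -exprnN mulrBr mulr1 mulVr ?opprB //.
    exact/unitrX/tvar_unit.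
  rewrite -bar_intr scaleNr rmorphN -scalerA /= bar_tvar_expz eE.
  by rewrite NegzE mulrNz scaleNr rmorphN /= scaler_nat rmorphMn.
have [e eE] := nat_case n; exists (qint tvar n); split=> // a.
by rewrite eE -bar_intr scaler_nat rmorphMn.
Qed.

(** The scalar [e] is the Gaussian binomial. Building it by the q-Pascal rule, by induction on
    [i + j], keeps it in the Laurent ring and yields Pascal's rule at [t = 1]. *)
Lemma qbinomial_quotient m i j : exists e : laurent K,
  [/\ qfact (tvar ^ m) (i + j) = e * (qfact (tvar ^ m) i * qfact (tvar ^ m) j)
    & forall a, bar (e *: a) = bar a *+ 'C(i + j, i)].
Proof.
set q := tvar ^ m.
have qf0 : qfact q 0 = 1 by rewrite /qfact big_ord0.
have [n le_n] := ubnP (i + j); elim: n => // n IHn in i j le_n *.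
case: i le_n => [|i] le_n.
  by exists 1; split=> [|a]; rewrite ?qf0 ?mul1r // scale1r bin0 mulr1n.
case: j le_n => [|j] le_n.
  exists 1; split=> [|a]; first by rewrite qf0 addn0 mulr1 mul1r.
  by rewrite scale1r addn0 binn mulr1n.
have [|e1 [e1E e1b]] := IHn i j.+1; first by rewrite -ltnS -addSn.
have [|e2 [e2E e2b]] := IHn i.+1 j; first by rewrite -ltnS -addnS.
exists (e1 + q ^+ i.+1 * e2); split=> [|a].
  (* The leading q-integer splits as (i+1)_q + q^(i+1) (j+1)_q; each summand absorbs one induction
     hypothesis. *)
  rewrite addSn qfactS -addSn qintD mulrDl.
  rewrite {1}e1E -[(i + j.+1)%N]addSnnS e2E !qfactS; ring.
rewrite scalerDl rmorphD -scalerA /= e1b /q exprnP exprz_exp.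
by rewrite bar_tvar_expz e2b -mulrnDr [in RHS]addSn binS addSnnS addnC.
Qed.

End ScalarsModT1.

(** * Divided powers of [Delta] and their reductions *)

Section HigherDerivation.
Variables (K : fieldType) (A : algType (laurent K)).
Hypothesis A_tf : torsion_free A.
Hypothesis A_comm : commutative (@GRing.mul (modt1 A)).
Variables (sigma : {lrmorphism A -> A}) (Delta : {linear A -> A}).
Hypothesis Delta_skew : skew_derivation sigma Delta.
Variable s : {linear A -> A}.
Hypothesis sE : forall a, t1 *: s a = sigma a - a.
Variable eta : int.
Hypothesis eta_neq0 : eta != 0.
Hypothesis Delta_sigma :
  forall a, Delta (sigma a) = tvar ^ eta *: sigma (Delta a).

Local Notation q := (tvar ^ eta : laurent K).
Local Notation c i := (t1 ^+ i * qfact q i).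

Variable D : nat -> {linear A -> A}.
Hypothesis DE : forall i a, c i *: D i a = iter i Delta a.

Let t1_neq0 : t1 != 0 :> laurent K. Proof. exact: tvarB1_neq0. Qed.

Lemma divided_power_denom_neq0 i : c i != 0.
Proof. by apply: mulf_neq0; [apply/expf_neq0/t1_neq0 | apply: qfact_neq0]. Qed.

Let cI i : injective (fun a : A => c i *: a).
Proof. exact/torsion_free_scalerI/divided_power_denom_neq0. Qed.

Let t1I : injective (fun a : A => t1 *: a).
Proof. exact/torsion_free_scalerI/t1_neq0. Qed.

Lemma iter_linearZ (f : {linear A -> A}) k e a :
  iter k f (e *: a) = e *: iter k f a.
Proof. by elim: k => //= k ->; rewrite linearZ. Qed.

Lemma divided_power0 a : D 0 a = a.
Proof. by rewrite -[LHS]scale1r -[RHS](DE 0 a) /qfact big_ord0 mulr1. Qed.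

Lemma Delta_divided_power n a : Delta (D n a) = (t1 * qint q n.+1) *: D n.+1 a.
Proof.
apply: (@cI n); rewrite /= -linearZ DE -iterS -DE scalerA qfactS exprS.
by congr (_ *: _); ring.
Qed.

Lemma divided_power1 (d : A -> A) :
  (forall a, t1 *: d a = Delta a) -> D 1 =1 d.
Proof.
by move=> dE a; apply: t1I; rewrite /= dE -[a in RHS]divided_power0
  Delta_divided_power qint1 mulr1.
Qed.

Lemma iter_Delta_sigma n a :
  iter n Delta (sigma a) = q ^+ n *: sigma (iter n Delta a).
Proof.
elim: n => [|n IHn]; first by rewrite expr0 scale1r.
by rewrite iterS IHn linearZ /= Delta_sigma scalerA -exprSr.
Qed.

Lemma divided_power_sigma n a : D n (sigma a) = q ^+ n *: sigma (D n a).
Proof.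
apply: (@cI n); rewrite /= DE iter_Delta_sigma -DE linearZ /=.
by rewrite !scalerA mulrC.
Qed.

(** Applies [D n] to [t1 *: s a = sigma a - a]; moving [D n] past [sigma] costs the factor [q ^+ n],
    whose excess over 1 is [t1 * e]. *)
Lemma divided_power_sigma_quotient n a (e : laurent K) : t1 * e = q ^+ n - 1 ->
  D n (s a) = s (D n a) + e *: sigma (D n a).
Proof.
move=> eE; apply: t1I; rewrite /= scalerDr scalerA eE -linearZ !sE.
by rewrite linearB divided_power_sigma scalerBl scale1r [RHS]addrC subrKA.
Qed.

Lemma divided_power_comp i j a (e : laurent K) :
    qfact q (i + j) = e * (qfact q i * qfact q j) ->
  D i (D j a) = e *: D (i + j) a.
Proof.
move=> eE; apply: (@cI i); apply: (@cI j); rewrite /= DE -iter_linearZ DE.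
rewrite -iterD -DE !scalerA eE exprD; congr (_ *: _); ring.
Qed.

(** This is (sigma^k - 1)/(t - 1) as a telescoping sum; its [k] summands all reduce to the same
    element. *)
Definition iter_sigma_quotient k a := \sum_(j < k) s (iter j sigma a).
Local Notation Y := iter_sigma_quotient.

Lemma iter_sigmaE k a : iter k sigma a = t1 *: Y k a + a.
Proof.
elim: k => [|k IHk]; first by rewrite /Y big_ord0 scaler0 add0r.
rewrite /Y big_ord_recr /= scalerDr sE -/(Y k a).
by rewrite addrAC -IHk addrC subrK.
Qed.

Lemma bar_iter_sigma k a : bar (iter k sigma a) = bar a.
Proof. by rewrite iter_sigmaE rmorphD /= bar_t1 add0r. Qed.

Lemma bar_iter_sigma_quotient k a :
  bar (Y k a) = modt1_map s (bar a) *+ k.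
Proof.
rewrite rmorph_sum -[in RHS](card_ord k) -sumr_const; apply: eq_bigr => j _.
by rewrite /= -modt1_mapE bar_iter_sigma.
Qed.

Lemma Delta_iter_sigma k a :
  Delta (iter k sigma a) = q ^+ k *: iter k sigma (Delta a).
Proof.
elim: k => [|k IHk]; first by rewrite expr0 scale1r.
by rewrite iterS Delta_sigma IHk linearZ scalerA exprS.
Qed.

(** Induction on [n]: applying [Delta] to the formula for [n] gives [t1 * qint q n.+1] times the one
    for [n.+1], a factor that torsion freeness cancels. *)
Lemma divided_powerM n a b :
  D n (a * b) = \sum_(i < n.+1) iter (n - i) sigma (D i a) * D (n - i) b.
Proof.
elim: n => [|n IHn]; first by rewrite big_ord1 !divided_power0.
have cn_neq0 : t1 * qint q n.+1 != 0.
  by apply: mulf_neq0; [apply: t1_neq0 | apply: qint_neq0].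
apply: (torsion_free_scalerI A_tf cn_neq0); rewrite /= -Delta_divided_power IHn.
pose G i := iter (n.+1 - i) sigma (D i a) * D (n.+1 - i) b.
(* [F] collects the terms where [Delta] hits the second factor, [H] those where it hits the first,
   which shifts the index by one. *)
pose F i := (t1 * qint q (n.+1 - i)) *: G i.
pose H i := (t1 * (q ^+ (n.+1 - i) * qint q i)) *: G i.
have -> : Delta (\sum_(i < n.+1) iter (n - i) sigma (D i a) * D (n - i) b) =
    \sum_(i < n.+1) (F i + H i.+1).
  rewrite linear_sum; apply: eq_bigr => i _.
  have le_in : (i <= n)%N by rewrite -ltnS.
  rewrite Delta_skew -iterS Delta_iter_sigma !Delta_divided_power /F /H /G
    subSS subSn //.
  by rewrite iter_linearZ -scalerAr -!scalerAl scalerA mulrCA.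
(* The added boundary terms [F n.+1] and [H 0] vanish because their q-integer is 0. *)
have -> : \sum_(i < n.+1) (F i + H i.+1) = \sum_(i < n.+2) (F i + H i).
  rewrite !big_split /=; congr (_ + _).
    rewrite [RHS]big_ord_recr /= [F n.+1]/F subnn /qint big_ord0.
    by rewrite mulr0 scale0r addr0.
  rewrite [RHS]big_ord_recl /= [H 0%N]/H /qint big_ord0.
  by rewrite !mulr0 scale0r add0r.
rewrite scaler_sumr; apply: eq_bigr => i _.
by rewrite /F /H -scalerDl -mulrDr -qintD subnK // -ltnS.
Qed.

Section Commutator.
Variable cm : A -> A -> A.
Hypothesis cmE : forall a b, t1 *: cm a b = a * b - b * a.

(** Expand [D n] on both products, reversing the second sum, and write each power of [sigma] as the
    identity plus [t1] times [Y]: the identity parts form commutators. *)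
Lemma divided_power_cm n a b :
  D n (cm a b) = \sum_(i < n.+1)
    (cm (D i a) (D (n - i) b)
     + (Y (n - i) (D i a) * D (n - i) b - Y i (D (n - i) b) * D i a)).
Proof.
apply: t1I; rewrite /= -linearZ cmE linearB !divided_powerM.
rewrite [X in _ - X](reindex_inj rev_ord_inj) /= -sumrB scaler_sumr.
apply: eq_bigr => i _; have le_in : (i <= n)%N by rewrite -ltnS.
rewrite subSS subKn // !iter_sigmaE scalerDr scalerBr cmE !scalerAl !mulrDl.
by rewrite opprD addrACA addrC.
Qed.

End Commutator.

Local Notation Dbar i := (modt1_map (D i)).

Lemma modt1_divided_power_higher : higher_derivation (fun i => Dbar i).
Proof.
split=> [n|u|n u v]; first exact: modt1_map_klinear.
  by have [a ->] := bar_surj u; rewrite modt1_mapE divided_power0.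
have [a ->] := bar_surj u; have [b ->] := bar_surj v.
rewrite -rmorphM modt1_mapE divided_powerM rmorph_sum; apply: eq_bigr => i _.
by rewrite rmorphM /= bar_iter_sigma !modt1_mapE.
Qed.

Lemma modt1_divided_power_skew_poisson :
  higher_skew_poisson_derivation (@scl_bracket K A) eta%:~R (modt1_map s)
    (fun i => Dbar i).
Proof.
have [cm [cmE brE]] := commutator_quotient A_tf A_comm.
split=> [|n u v|n u]; first exact: modt1_divided_power_higher.
  have [a ->] := bar_surj u; have [b ->] := bar_surj v.
  rewrite brE modt1_mapE (divided_power_cm cmE) rmorph_sum.
  under eq_bigr => i _ do
    rewrite rmorphD rmorphB !rmorphM /= !bar_iter_sigma_quotient -brE.
  (* The first [Y] sum carries weight [n - i]; reversing it gives both correction sums the weight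
     [i]. *)
  rewrite big_split /= sumrB [X in _ + (X - _)](reindex_inj rev_ord_inj) /=.
  rewrite -sumrB -big_split; apply: eq_bigr => i _ /=.
  have le_in : (i <= n)%N by rewrite -ltnS.
  rewrite subSS subKn // !modt1_mapE mulrnBl !mulrnAl.
  by rewrite (A_comm (bar (D i a))).
have [a ->] := bar_surj u.
have [e [eE ebar]] := tvar_expz_quotient A (eta * n%:Z).
have en : t1 * e = q ^+ n - 1 by rewrite eE exprnP exprz_exp.
rewrite !modt1_mapE (divided_power_sigma_quotient _ en) rmorphD /= ebar
  (bar_sigma sE).
by rewrite intrM mulrC.
Qed.

Lemma modt1_divided_power_iterative : iterative (fun i => Dbar i).
Proof.
move=> i j u; have [a ->] := bar_surj u.
have [e [eE ebar]] := qbinomial_quotient A eta i j.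
by rewrite !modt1_mapE (divided_power_comp _ eE) ebar.
Qed.

Lemma modt1_divided_power_locally_nilpotent :
  locally_nilpotent Delta -> higher_locally_nilpotent (fun i => Dbar i).
Proof.
move=> nil u; have [a ->] := bar_surj u; have [n n0] := nil a.
exists n => i le_ni; rewrite modt1_mapE; have -> : D i a = 0; last first.
  exact: rmorph0.
apply: (@cI i); rewrite /= DE scaler0 -(subnK le_ni) iterD n0.
(* Writing 0 as [0 *: 0] lets homogeneity of the iterates show that they kill it. *)
by rewrite -(scale0r 0) iter_linearZ !scale0r.
Qed.

End HigherDerivation.

(** * Assembly of both parts of the statement *)

Lemma iter_linear (L : pzRingType) (V : lmodType L) (f : {linear V -> V}) n :
  exists g : {linear V -> V}, g =1 iter n f.
Proof.
elim: n => [|n [g gE]]; first by exists idfun.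
by exists (f \o g) => a; rewrite /= gE.
Qed.

Theorem proposition4p1 (K : fieldType)
  (A : algType (laurent K)) (A_torsion_free : torsion_free A)
  (sigma : {lrmorphism A -> A}) (sigma_bij : bijective sigma)
  (Delta : {linear A -> A}) (Delta_skew : skew_derivation sigma Delta)
  (R : algType (laurent K)) (iota : {lrmorphism A -> R}) (x : R)
  (R_ore : ore_extension iota x sigma Delta)
  (R_comm : commutative (@GRing.mul (modt1 R))) :
  exists alpha delta : modt1 A -> modt1 A,
  [/\ (forall a : A, exists2 w : A,
         is_frac (sigma a - a) (tvar - 1) w & alpha (bar a) = bar w),
      (forall a : A, exists2 w : A,
         is_frac (Delta a) (tvar - 1) w & delta (bar a) = bar w),
      (exists2 iota1 : modt1 A -> modt1 R,
         (forall a : A, iota1 (bar a) = bar (iota a))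
       & poisson_ore_extension (@scl_bracket K A) (@scl_bracket K R)
           iota1 (bar x) alpha delta)
    & (forall eta : int,
         eta%:~R != 0 :> K ->
         (forall a : A, Delta (sigma a) = tvar ^ eta *: sigma (Delta a)) ->
         (forall (i : nat) (a : A), exists b : A,
            iter i Delta a = ((tvar - 1) ^+ i * qfact (tvar ^ eta) i) *: b) ->
         exists D : nat -> modt1 A -> modt1 A,
         [/\ (forall (i : nat) (a : A), exists2 w : A,
                is_frac (iter i Delta a)
                        ((tvar - 1) ^+ i * qfact (tvar ^ eta) i) w
              & D i (bar a) = bar w),
             higher_skew_poisson_derivation (@scl_bracket K A)
               eta%:~R alpha D,
             iterative D,
             D 1%N =1 delta
           & (locally_nilpotent Delta -> higher_locally_nilpotent D)])].
Proof.
have A_comm := basis_powers_modt1_comm R_ore.1 R_comm.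
have t1_neq0 := tvarB1_neq0 K.
(* The quotients [s] and [d] are lifts of alpha and delta to [A]. *)
have [s sE] := linear_quotient A_torsion_free (f := sigma \- idfun) t1_neq0
  (fun a => (ore_extension_divisible R_ore.1 R_ore R_comm a).1).
have [d dE] := linear_quotient A_torsion_free t1_neq0
  (fun a => (ore_extension_divisible R_ore.1 R_ore R_comm a).2).
exists (modt1_map s), (modt1_map d); split.
- move=> a; exists (s a); last exact: modt1_mapE.
  exact: (torsion_free_frac _ _ (sE a)).
- move=> a; exists (d a); last exact: modt1_mapE.
  exact: (torsion_free_frac _ _ (dE a)).
- exists (modt1_map iota); first exact: modt1_mapE.
  exact: (modt1_poisson_ore A_torsion_free A_comm Delta_skew sE dE R_ore
    R_comm).
move=> eta etaK_neq0 Delta_sigma Delta_div.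
(* A nonzero image in [K] forces a nonzero integer, so the denominators of the [D i] do not
   vanish. *)
have eta_neq0 : eta != 0.
  by apply: contraNneq etaK_neq0 => ->; rewrite mulr0z.
have D_exists i : exists D : {linear A -> A}, forall a,
    ((tvar - 1) ^+ i * qfact (tvar ^ eta) i) *: D a = iter i Delta a.
  have [g gE] := iter_linear Delta i.
  have [|D DE] := linear_quotient (f := g) A_torsion_free
    (divided_power_denom_neq0 K eta_neq0 i).
    by move=> a; rewrite gE; apply: Delta_div.
  by exists D => a; rewrite DE gE.
have [D DE] : exists D : nat -> {linear A -> A}, forall i a,
    ((tvar - 1) ^+ i * qfact (tvar ^ eta) i) *: D i a = iter i Delta a.
  by exists (fun i => projT1 (cid (D_exists i))) => i; case: cid.
exists (fun i => modt1_map (D i)); split.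
- move=> i a; exists (D i a); last exact: modt1_mapE.
  apply: (torsion_free_frac A_torsion_free _ (DE i a)).
  exact: divided_power_denom_neq0.
- exact: (modt1_divided_power_skew_poisson A_torsion_free A_comm Delta_skew
    sE eta_neq0 Delta_sigma DE).
- exact: (modt1_divided_power_iterative A_torsion_free eta_neq0 DE).
- move=> u; have [a ->] := bar_surj u; rewrite !modt1_mapE.
  by rewrite (divided_power1 A_torsion_free eta_neq0 DE dE).
- exact: (modt1_divided_power_locally_nilpotent A_torsion_free eta_neq0 DE).
Qed.
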